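(* Let $X$ be a reflexive (real) Banach space. (1) If $L: X\times X^*\to \mathbb{R}\cup\{+\infty\}$ is a proper selfdual Lagrangian, then the (set-valued) vector field $u\mapsto \bar\partial L(u)$ from $X$ to $2^{X^*}$ is maximal monotone. (2) Conversely, if $T: D(T)\subset X\to 2^{X^*}$ is a maximal monotone operator with non-empty domain $D(T)$, then there exists a selfdual Lagrangian $L$ on $X\times X^*$ such that $T=\bar\partial L$.
   Context: A selfdual Lagrangian on $X\times X^*$ ($X$ reflexive) is a function $L:X\times X^*\to\mathbb{R}\cup\{+\infty\}$ that is convex and lower semi-continuous jointly in both variables and satisfies $L^*(p,u)=L(u,p)$ for all $(p,u)\in X^*\times X$, where $L^*$ is the Legendre transform in both variables, $$L^*(p,u)=\sup\{\langle p,y\rangle+\langle u,q\rangle-L(y,q);\ (y,q)\in X\times X^*\}.$$ For a Lagrangian $L$ and $u\in X$, $\bar\partial L(u):=\{p\in X^*;\ L(u,p)-\langle u,p\rangle=0\}$ (possibly empty). A set-valued operator $T:X\to 2^{X^*}$ has graph $G(T)=\{(x,p)\in X\times X^*;\ p\in T(x)\}$ and effective domain $D(T)=\{u\in X;\ T(u)\neq\emptyset\}$. $T$ is monotone if $\langle u-v,p-q\rangle\ge 0$ for all $(u,p),(v,q)\in G(T)$, and maximal monotone if moreover $G(T)$ is maximal for inclusion among monotone subsets of $X\times X^*$. *)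

(* Defs.v *)
From HB Require Import structures.
From mathcomp Require Import all_boot all_order all_algebra.
From mathcomp Require Import all_classical all_reals all_analysis.

Set Implicit Arguments.
Unset Strict Implicit.
Unset Printing Implicit Defensive.

Import Order.TTheory GRing.Theory Num.Theory.
Import numFieldNormedType.Exports.

Local Open Scope classical_set_scope.
Local Open Scope ring_scope.

Section dual_pred.
Context {R : realType} {X : normedModType R}.

Definition dual_pred : {pred X -> R^o} :=
  mem [set p : X -> R^o | linear p /\ continuous p].

Lemma dual_pred_submod_closed : submod_closed dual_pred.
Proof.
split=> [|a f g]; rewrite !inE /=.
  split; last exact: cst_continuous.
  by move=> b x y /=; rewrite scaler0 addr0.
move=> [lf cf] [lg cg]; split.
  move=> b x y /=; rewrite !fctE lf lg /= !scalerDr !scalerA mulrC.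
  by rewrite addrACA.
move=> x; apply: (@continuousD R R^o X (a *: f) g x); last exact: cg.
by apply: (@continuousZl_tmp R R^o X f a x); exact: cf.
Qed.

HB.instance Definition _ := GRing.isSubmodClosed.Build R (X -> R^o) dual_pred
  dual_pred_submod_closed.

End dual_pred.

(* The topological dual X^*; below it receives the operator norm, hence the
   norm topology. *)
Record dual_space (R : realType) (X : normedModType R) : Type := DualSpace {
  dual_fun :> X -> R^o ;
  dual_funP : dual_fun \in @dual_pred R X }.

Section dual_structure.
Context {R : realType} {X : normedModType R}.
Local Notation X' := (dual_space X).

HB.instance Definition _ := [isSub for @dual_fun R X].
HB.instance Definition _ := [Choice of X' by <:].
HB.instance Definition _ := [SubChoice_isSubLmodule of X' by <:].

Lemma dual_linear (p : X') : linear p.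
Proof. by have /set_mem[] := dual_funP p. Qed.

Lemma dual_continuous (p : X') : continuous p.
Proof. by have /set_mem[] := dual_funP p. Qed.

HB.instance Definition _ (p : X') :=
  GRing.isLinear.Build R X R^o *:%R p (dual_linear p).

Definition dual_norm (p : X') : R :=
  sup [set `|p x| | x in [set x | `|x| <= 1]].

Lemma dual_norm_has_sup (p : X') :
  has_sup [set `|p x| | x in [set x | `|x| <= 1]].
Proof.
split; first by exists `|p 0|, 0 => //=; rewrite normr0.
have /linear_bounded_continuous/bounded_funP/(_ 1)[M pM] := @dual_continuous p.
by exists M => _ [x /= x1 <-]; exact: pM.
Qed.

Lemma dual_norm_ub (p : X') x : `|x| <= 1 -> `|p x| <= dual_norm p.
Proof.
by move=> x1; apply: (sup_upper_bound (dual_norm_has_sup p)); exists x.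
Qed.

Lemma dual_norm_le (p : X') (M : R) :
  (forall x, `|x| <= 1 -> `|p x| <= M) -> dual_norm p <= M.
Proof.
move=> pM; apply: ge_sup; first by have [] := dual_norm_has_sup p.
by move=> _ [x /= x1 <-]; exact: pM.
Qed.

Lemma dual_norm_ge0 (p : X') : 0 <= dual_norm p.
Proof.
by apply: le_trans (@dual_norm_ub p 0 _); rewrite ?normr0.
Qed.

Lemma dual_normP (p : X') x : `|p x| <= dual_norm p * `|x|.
Proof.
have [->|x0] := eqVneq x 0; first by rewrite linear0 !normr0 mulr0.
have nx : 0 < `|x| by rewrite normr_gt0.
have := @dual_norm_ub p (`|x|^-1 *: x).
rewrite linearZ !normrZ normfV normr_id mulVf ?gt_eqF// => /(_ (lexx _)).
by rewrite ler_pdivrMl// mulrC.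
Qed.

Lemma dual_ler_normD (p q : X') :
  dual_norm (p + q) <= dual_norm p + dual_norm q.
Proof.
apply: dual_norm_le => x x1; apply: le_trans (ler_normD _ _) _.
by apply: lerD; exact: dual_norm_ub.
Qed.

Lemma dual_normrZ (a : R) (p : X') : dual_norm (a *: p) = `|a| * dual_norm p.
Proof.
have le_normZ b (q : X') : dual_norm (b *: q) <= `|b| * dual_norm q.
  apply: dual_norm_le => x x1; rewrite [X in `|X|]/(b * q x) normrM.
  by rewrite ler_wpM2l// dual_norm_ub.
have [->|a0] := eqVneq a 0.
  apply/eqP; rewrite eq_le le_normZ/= normr0 mul0r.
  exact: dual_norm_ge0.
apply/eqP; rewrite eq_le le_normZ/=.
have := le_normZ a^-1 (a *: p); rewrite scalerA mulVf// scale1r normfV.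
by rewrite ler_pdivlMl// normr_gt0.
Qed.

Lemma dual_normr0_eq0 (p : X') : dual_norm p = 0 -> p = 0.
Proof.
move=> p0; apply/val_inj/funext => x /=; apply/normr0_eq0/eqP.
by rewrite eq_le normr_ge0 andbT (le_trans (dual_normP p x))// p0 mul0r.
Qed.

HB.instance Definition _ := Lmodule_isNormed.Build R X'
  dual_ler_normD dual_normrZ dual_normr0_eq0.

End dual_structure.

Definition reflexive_space (R : realType) (X : normedModType R) : Prop :=
  forall F : dual_space (dual_space X),
    exists x : X, forall p : dual_space X, F p = p x.

Section lagrangian.
Context {R : realType} {X : normedModType R}.
Local Open Scope ereal_scope.

Definition legendre (L : X * dual_space X -> \bar R) :
    dual_space X * X -> \bar R :=
  fun pu => ereal_sup
    (range (fun yq : X * dual_space X =>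
       (pu.1 yq.1)%:E + (yq.2 pu.2)%:E - L yq)).

Definition proper_function (T : Type) (f : T -> \bar R) : Prop :=
  (forall z, f z != -oo) /\ (exists z, f z < +oo).

(* At t = 0 or t = 1 the library's convention 0 * +oo = 0 makes the inequality
   trivial, as it should be. *)
Definition econvex (E : lmodType R) (f : E -> \bar R) : Prop :=
  forall (x y : E) (t : R), (0 <= t <= 1)%R ->
    f (t *: x + (1 - t) *: y)%R <= t%:E * f x + (1 - t)%:E * f y.

(* The first clause says that L takes its values in R `|` {+oo}. *)
Definition selfdual_lagrangian (L : X * dual_space X -> \bar R) : Prop :=
  [/\ forall z, L z != -oo,
      econvex L,
      lower_semicontinuous L &
      forall (p : dual_space X) (u : X), legendre L (p, u) = L (u, p)].

Definition dbar (L : X * dual_space X -> \bar R) (u : X) : set (dual_space X) :=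
  [set p | L (u, p) - (p u)%:E = 0].

End lagrangian.

Section operators.
Context {R : realType} {X : normedModType R}.

Definition op_graph (T : X -> set (dual_space X)) : set (X * dual_space X) :=
  [set xp | T xp.1 xp.2].

Definition op_domain (T : X -> set (dual_space X)) : set X :=
  [set u | T u !=set0].

Definition monotone_set (G : set (X * dual_space X)) : Prop :=
  forall u p v q, G (u, p) -> G (v, q) -> 0 <= (p - q) (u - v).

Definition maximal_monotone (T : X -> set (dual_space X)) : Prop :=
  monotone_set (op_graph T) /\
  forall G : set (X * dual_space X),
    monotone_set G -> op_graph T `<=` G -> G `<=` op_graph T.

End operators.

(* Main.v *)
(* Write Z for X x X*, put B((x,p),(y,q)) = <p,y> + <q,x> and
   Q(x,p) = (|x|^2 + |p|^2)/2. By reflexivity, and the Hahn-Banach theorem,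
   Z is its own dual through B, and Q is its own conjugate; L is selfdual when
   it is its own conjugate, which forces L(z) >= B(z,z)/2, with equality
   exactly on the graph of the field of L.
   (1) Monotonicity of the field is the convexity of L at a midpoint. If z is
   monotonically related to the graph, Fenchel duality between the translate of
   L by z and Q yields v with L(z+v) <= B(z,z)/2 + B(z,v) - Q(v); then z + v is
   in the graph and Q(v) <= -B(v,v)/2 <= 0, so v = 0.
   (2) Let f be the Fitzpatrick function of the graph G of T and g its
   conjugate, so that f is also the conjugate of g. The proximal average
   L(z) = inf_w (f(z+w) + g(z-w))/2 + Q(w) is selfdual, by Fenchel duality
   again, and equals B(z,z)/2 on G; hence the field of L is a monotone
   extension of T, and is T by maximality. *)
From HB Require Import structures.
Require Import Defs.
From mathcomp Require Import all_boot all_order all_algebra.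
From mathcomp Require Import all_classical all_reals all_analysis.
From mathcomp Require Import ring lra.
Import numFieldNormedType.Exports.
Import Order.TTheory GRing.Theory Num.Theory.
Local Open Scope classical_set_scope.
Local Open Scope ring_scope.
Set Implicit Arguments.
Unset Strict Implicit.
Unset Printing Implicit Defensive.

(** * The Hahn-Banach theorem for convex epigraphs *)

Definition convex_graph (R : realType) (V : lmodType R) (C : set (V * R)) :=
  forall (x y : V) (r s t : R), 0 <= t <= 1 -> C (x, r) -> C (y, s) ->
    C (t *: x + (1 - t) *: y, t * r + (1 - t) * s).

Section hahn_banach.
Context {R : realType} {V : lmodType R}.
Implicit Types (C : set (V * R)) (x : V) (a : R).

(** The Minkowski sum of [C] with the line spanned by [(x, a)]. *)
Definition shift_closure C x a : set (V * R) :=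
  [set zr | exists s, C (zr.1 + s *: x, zr.2 + s * a)].

Lemma convex_shift_closure C x a :
  convex_graph C -> convex_graph (shift_closure C x a).
Proof.
move=> Ccvx y z r s t t01 [/= b Cb] [/= c Cc].
exists (t * b + (1 - t) * c) => /=.
rewrite [X in C X](_ : _ = (t *: (y + b *: x) + (1 - t) *: (z + c *: x),
  t * (r + b * a) + (1 - t) * (s + c * a))); first exact: Ccvx.
congr (_, _); last by ring.
by rewrite !scalerDr [in LHS](scalerDl x) !scalerA addrACA.
Qed.

(** The one-dimensional extension step: [a] has to separate the slopes of [C] in the direction [x]
    from those in the direction [- x]. *)
Lemma exists_nonneg_shift C x : convex_graph C ->
    (forall y, exists r, C (y, r)) -> (forall r, C (0, r) -> 0 <= r) ->
  exists a, forall r, shift_closure C x a (0, r) -> 0 <= r.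
Proof.
move=> Ccvx Ctot C0.
pose slopes := [set q | exists s r, [/\ 0 < s, C (s *: x, r) & q = r / s]].
(* The convex combination with weight [s / (s + s')] on the point above [s' *: x] lies above [0], so
   its height is nonnegative. *)
have slopes_ge s r : 0 < s -> C (- (s *: x), r) -> lbound slopes (- r / s).
  move=> s0 Cs _ [s' [r' [s'0 Cs' ->]]].
  have ss'_gt0 : 0 < s + s' by rewrite addr_gt0.
  have ss'_neq0 : s + s' != 0 by rewrite gt_eqF.
  have t01 : 0 <= s / (s + s') <= 1.
    by rewrite divr_ge0 ?ler_pdivrMr//=; lra.
  have := Ccvx _ _ _ _ _ t01 Cs' Cs.
  have -> : (s / (s + s')) *: (s' *: x) + (1 - s / (s + s')) *: - (s *: x) = 0.
    rewrite scalerN !scalerA -scalerBl (_ : _ - _ = 0) ?scale0r//.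
    by field.
  have -> : s / (s + s') * r' + (1 - s / (s + s')) * r =
      (s * r' + s' * r) / (s + s') by field.
  move/C0; rewrite pmulr_lge0 ?invr_gt0// => h.
  by rewrite ler_pdivrMr// mulrAC ler_pdivlMr//; lra.
have slopes0 : slopes !=set0.
  by have [r Cr] := Ctot (1 *: x); exists (r / 1), 1, r.
exists (inf slopes) => r [/= s]; rewrite add0r.
have [s0|s0|->] := ltgtP s 0; last 1 first.
- by rewrite scale0r mul0r addr0 => /C0.
- move=> Cs; have s'0 : 0 < - s by rewrite oppr_gt0.
  have := @lb_le_inf _ slopes (- (r + s * inf slopes) / - s) slopes0.
  rewrite -[s in s *: x]opprK scaleNr in Cs.
  move=> /(_ (slopes_ge _ _ s'0 Cs)).
  rewrite ler_pdivrMr//; lra.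
- move=> Cs.
  have: inf slopes <= (r + s * inf slopes) / s.
    apply: ge_inf; last by exists s, (r + s * inf slopes).
    have [r' Cr'] := Ctot (- (1 *: x)).
    by exists (- r' / 1); apply: slopes_ge.
  by rewrite ler_pdivlMr//; lra.
Qed.

Lemma exists_maximal_convex_graph C : convex_graph C -> C !=set0 ->
    (forall r, C (0, r) -> 0 <= r) ->
  exists A, [/\ convex_graph A, C `<=` A, forall r, A (0, r) -> 0 <= r &
    forall B, convex_graph B -> (forall r, B (0, r) -> 0 <= r) -> A `<=` B ->
      B `<=` A].
Proof.
move=> Ccvx [c Cc] C0.
(* The guard [A !=set0] lets the empty set, which is the union of the empty chain, satisfy [P]. *)
pose P A := [/\ convex_graph A, A !=set0 -> C `<=` A &
  forall r, A (0, r) -> 0 <= r].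
have [F FP Ftot|A [[Acvx CA A0] Amax]] := @Zorn_bigcup (V * R)%type P.
  split.
  - move=> x y r s t t01 [A FA Ar] [B FB Bs].
    have [AB|BA] := Ftot _ _ FA FB; [exists B|exists A] => //.
      by have [+ _ _] := FP _ FB; apply => //; exact: AB.
    by have [+ _ _] := FP _ FA; apply => //; exact: BA.
  - move=> [z [A FA Az]] y Cy; exists A => //.
    by have [_ + _] := FP _ FA; apply => //; exists z.
  - by move=> r [A FA Ar]; have [_ _] := FP _ FA; exact.
have An0 : A !=set0.
  apply: contrapT => An0; apply: (Amax C); last first.
    by split=> // _; exact: subset_refl.
  split; first by move=> z Az; exfalso; apply: An0; exists z.
  by move=> /(_ c Cc) Ac; apply: An0; exists c.
exists A; split => //; first exact: CA.
move=> B Bcvx B0 AB; apply: contrapT => BA; apply: (Amax B); first by split.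
by split=> // _; apply: subset_trans (CA An0) AB.
Qed.

(* Zorn's lemma provides a maximal convex set containing [C] and lying above
   the origin on the vertical axis; maximality makes it invariant under one
   translation direction [(x, l x)] for each [x]. *)
Theorem hahn_banach C : convex_graph C -> (forall x, exists r, C (x, r)) ->
    (forall r, C (0, r) -> 0 <= r) ->
  exists l : V -> R, (forall a x y, l (a *: x + y) = a * l x + l y) /\
    forall x r, C (x, r) -> l x <= r.
Proof.
move=> Ccvx Ctot C0.
have [|A [Acvx CA A0 Amax]] := exists_maximal_convex_graph Ccvx _ C0.
  by have [r ?] := Ctot 0; exists (0, r).
have Atot x : exists r, A (x, r).
  by have [r /CA] := Ctot x; exists r.
pose T x a := forall z r s, A (z, r) -> A (z + s *: x, r + s * a).
have /choice[l Tl] : forall x, exists a, T x a => [x|].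
  have [a ha] := exists_nonneg_shift x Acvx Atot A0.
  exists a => z r s Azr.
  apply: (Amax (shift_closure A x a)) => //.
  - exact: convex_shift_closure.
  - by move=> [y q] Ay; exists 0; rewrite scale0r mul0r !addr0.
  - by exists (- s) => /=; rewrite scaleNr mulNr !addrK.
(* Two slopes at [x] would make [A] invariant under all vertical translations, against [A0]. This
   uniqueness is what makes [l] linear. *)
have Tuniq x a b : T x a -> T x b -> a = b.
  move=> Ta Tb; have [r Ar] := Atot 0.
  have h s : 0 <= r + s * (a - b).
    apply: A0; have := Tb _ _ (- s) (Ta _ _ s Ar).
    by rewrite scaleNr addrK mulNr -addrA mulrBr.
  apply: contrapT => /eqP ab; have := h (- (r + 1) / (a - b)).
  by rewrite divfK ?subr_eq0//; lra.
exists l; split=> [c x y|x r /CA Axr].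
  apply: (Tuniq (c *: x + y)); first exact: Tl.
  move=> z r s Azr; have := Tl y _ _ s (Tl x _ _ (s * c) Azr).
  by rewrite scalerDr scalerA mulrDr mulrA !addrA.
have := Tl x _ _ (- 1) Axr; rewrite scaleN1r subrr mulN1r => /A0.
by rewrite subr_ge0.
Qed.

End hahn_banach.

(** * Continuous linear functionals *)

Section dual_elements.
Context {R : realType} {X : normedModType R}.
Implicit Types (x y : X) (p q : dual_space X).

Lemma dualDE p q x : (p + q) x = p x + q x. Proof. by []. Qed.
Lemma dualNE p x : (- p) x = - p x. Proof. by []. Qed.
Lemma dualZE (a : R) p x : (a *: p) x = a * p x. Proof. by []. Qed.
Lemma dualD p x y : p (x + y) = p x + p y. Proof. exact: linearD. Qed.
Lemma dualN p x : p (- x) = - p x. Proof. exact: linearN. Qed.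
Lemma dualZ p (a : R) x : p (a *: x) = a * p x. Proof. exact: linearZ. Qed.

(** By symmetry of the unit ball the one-sided bound is two-sided, and a bounded linear form is
    continuous. *)
Lemma dual_of_linear (f : X -> R) (M : R) :
    (forall a x y, f (a *: x + y) = a * f x + f y) ->
    (forall x, `|x| <= 1 -> f x <= M) ->
  exists p : dual_space X, p =1 f.
Proof.
move=> flin fM; have fl : linear (f : X -> R^o) := flin.
pose fL := GRing.isLinear.Build R X R^o *:%R (f : X -> R^o) fl.
pose g : {linear X -> R^o} := HB.pack (f : X -> R^o) fL.
have gM x : `|x| <= 1 -> `|g x| <= M.
  move=> x1; rewrite ler_norml fM// andbT lerNl -linearN.
  by apply: fM; rewrite normrN.
have gc : continuous g.
  apply/linear_bounded_continuous/bounded_funP => r.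
  have k0 : 0 < `|r| + 1 by rewrite ltr_wpDl.
  exists ((`|r| + 1) * M) => x xr.
  have /gM : `|(`|r| + 1)^-1 *: x| <= 1.
    rewrite normrZ normfV gtr0_norm// ler_pdivrMl// mulr1.
    by apply: (le_trans xr); rewrite (le_trans (ler_norm r))// lerDl.
  by rewrite linearZ normrZ normfV gtr0_norm// ler_pdivrMl.
have gP : (g : X -> R^o) \in @dual_pred R X by apply/mem_set; split.
by exists (DualSpace gP).
Qed.

Lemma le_dual_norm p x : p x <= `|p| * `|x|.
Proof. exact: le_trans (ler_norm _) (dual_normP p x). Qed.

(* A linear [l] with [l x <= |x + y| - |y|] has norm at most [1], and taking
   [x = - y] shows that it is norming at [y]. *)
Lemma exists_norming_functional y :
  exists p : dual_space X, `|p| <= 1 /\ p y = `|y|.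
Proof.
pose C := [set zr : X * R | `|zr.1 + y| - `|y| <= zr.2].
have [||r|l [llin lC]] := @hahn_banach R X C.
- move=> x1 x2 r s t /andP[t0 t1]; rewrite /C /= => h1 h2.
  have -> : t *: x1 + (1 - t) *: x2 + y = t *: (x1 + y) + (1 - t) *: (x2 + y).
    by rewrite !scalerDr addrACA -scalerDl [t + _]addrC subrK scale1r.
  have t1' : 0 <= 1 - t by rewrite subr_ge0.
  apply: le_trans (lerB (ler_normD _ _) (lexx _)) _.
  by rewrite !normrZ (ger0_norm t0) (ger0_norm t1'); nra.
- by move=> x; exists (`|x + y| - `|y|); rewrite /C /=.
- by rewrite /C /= add0r subrr.
have l_le x : l x <= `|x + y| - `|y| by apply: lC; rewrite /C /=.
have lle x : l x <= `|x|.
  apply: le_trans (l_le x) _.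
  by rewrite lerBlDr ler_normD.
have [|p pl] := @dual_of_linear l 1 llin.
  by move=> x; apply: le_trans (lle x).
exists p; split.
  apply: dual_norm_le => x x1; rewrite ler_norml !pl (le_trans (lle x))// andbT.
  by rewrite -pl lerNl -dualN pl (le_trans (lle _))// normrN.
apply/eqP; rewrite eq_le pl lle/=.
have := l_le (- y); rewrite addNr normr0 sub0r -!pl dualN.
by rewrite lerN2.
Qed.

End dual_elements.

(** * The pairing, the energy and Fenchel duality *)

Section pairing.
Context {R : realType} {X : normedModType R}.
Local Notation Z := (X * dual_space X)%type.
Implicit Types (z w v : Z) (a : R).

(* This symmetric pairing identifies the dual of [Z] with [Z] itself: the value
   of [legendre L] at [(z.2, z.1)] is [sup_w (pairing z w - L w)]. *)
Definition pairing z w : R := z.2 w.1 + w.2 z.1.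

Definition energy z : R := (`|z.1| ^+ 2 + `|z.2| ^+ 2) / 2.

Lemma pairingC z w : pairing z w = pairing w z.
Proof. exact: addrC. Qed.

Lemma pairingDl z w v : pairing (z + w) v = pairing z v + pairing w v.
Proof. by rewrite /pairing [(z + w).1]/(z.1 + w.1) dualD dualDE; ring. Qed.

Lemma pairingNl z w : pairing (- z) w = - pairing z w.
Proof. by rewrite /pairing [(- z).1]/(- z.1) dualN dualNE; ring. Qed.

Lemma pairingZl a z w : pairing (a *: z) w = a * pairing z w.
Proof. by rewrite /pairing [(a *: z).1]/(a *: z.1) dualZ dualZE; ring. Qed.

Lemma pairingDr z w v : pairing v (z + w) = pairing v z + pairing v w.
Proof. by rewrite !(pairingC v) pairingDl. Qed.

Lemma pairingNr z w : pairing w (- z) = - pairing w z.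
Proof. by rewrite !(pairingC w) pairingNl. Qed.

Lemma pairingZr a z w : pairing w (a *: z) = a * pairing w z.
Proof. by rewrite !(pairingC w) pairingZl. Qed.

Definition pairingE := (pairingDl, pairingDr, pairingNl, pairingNr, pairingZl,
  pairingZr).

Lemma energyN z : energy (- z) = energy z.
Proof. by rewrite /energy /= !normrN. Qed.

Lemma energy_eq0 z : energy z <= 0 -> z = 0.
Proof.
case: z => x p; rewrite /energy /= => h.
have [x0 p0] : `|x| = 0 /\ `|p| = 0.
  by have := normr_ge0 x; have := normr_ge0 p; split; nra.
by rewrite (normr0_eq0 x0) (normr0_eq0 p0).
Qed.

(** Young's inequality for each of the two products of norms: the conjugate of [energy] is at most
    [energy]. *)
Lemma pairing_le_energy z w : pairing z w <= energy z + energy w.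
Proof.
rewrite /pairing /energy; have := le_dual_norm z.2 w.1.
have := le_dual_norm w.2 z.1.
have := sqr_ge0 (`|z.1| - `|w.2|); have := sqr_ge0 (`|z.2| - `|w.1|).
by rewrite !sqrrB; lra.
Qed.

Lemma energy_convex t z w : 0 <= t <= 1 ->
  energy (t *: z + (1 - t) *: w) <= t * energy z + (1 - t) * energy w.
Proof.
move=> /andP[t0 t1]; have t1' : 0 <= 1 - t by rewrite subr_ge0.
have sq_convex (V : normedModType R) (x y : V) :
    `|t *: x + (1 - t) *: y| ^+ 2 <= t * `|x| ^+ 2 + (1 - t) * `|y| ^+ 2.
  have := ler_normD (t *: x) ((1 - t) *: y).
  rewrite !normrZ (ger0_norm t0) (ger0_norm t1').
  have := normr_ge0 (t *: x + (1 - t) *: y).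
  move: `|_ + _| => n n0 hn.
  apply: (@le_trans _ _ ((t * `|x| + (1 - t) * `|y|) ^+ 2)).
    by rewrite ler_pXn2r// ?nnegrE ?(le_trans n0).
  have := mulr_ge0 (mulr_ge0 t0 t1') (sqr_ge0 (`|x| - `|y|)).
  by rewrite !expr2; lra.
have := sq_convex _ z.1 w.1; have := sq_convex _ z.2 w.2.
by rewrite /energy /=; lra.
Qed.

(** The opposite inequality between [energy] and its conjugate. The test points are
    [- (|q| x, |y| p)], with [p] norming at [y] and [x] running over the unit ball. *)
Lemma energy_le_of_conjugate v (c : R) :
  (forall w, - pairing v w - energy w <= c) -> energy v <= c.
Proof.
case: v => y q h; have [p [p1 py]] := exists_norming_functional y.
have hq x : `|x| <= 1 -> `|q| * q x <= c + (`|q| ^+ 2 - `|y| ^+ 2) / 2.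
  move=> x1; have := h (- (`|q| *: x, `|y| *: p)).
  have -> : pairing (y, q) (- (`|q| *: x, `|y| *: p)) =
      - (`|q| * q x + `|y| ^+ 2).
    by rewrite pairingNr /pairing [X in q X]/= dualZ dualZE py expr2.
  rewrite energyN opprK /energy /= !normrZ !normr_id !exprMn.
  have x2 : `|q| ^+ 2 * `|x| ^+ 2 <= `|q| ^+ 2.
    by rewrite ler_piMr ?sqr_ge0// expr_le1.
  have p2 : `|y| ^+ 2 * `|p| ^+ 2 <= `|y| ^+ 2.
    by rewrite ler_piMr ?sqr_ge0// expr_le1.
  by lra.
suff : `|q| * `|q| <= c + (`|q| ^+ 2 - `|y| ^+ 2) / 2.
  by rewrite /energy /=; lra.
have [q0|q0] := eqVneq `|q| 0.
  by have := hq 0; rewrite normr0 q0 !mul0r => /(_ ler01).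
have q_gt0 : 0 < `|q| by rewrite lt_neqAle eq_sym q0 normr_ge0.
rewrite -ler_pdivlMl// mulrC; apply: dual_norm_le => x x1.
have qle u : `|u| <= 1 -> q u <= (c + (`|q| ^+ 2 - `|y| ^+ 2) / 2) / `|q|.
  by move=> u1; rewrite ler_pdivlMr// mulrC hq.
by rewrite ler_norml qle// andbT lerNl -dualN qle// normrN.
Qed.

(** The restrictions of [l] to the two factors lie in the dual and in the bidual; reflexivity turns
    the latter into a point of [X]. *)
Lemma pairing_of_linear (reflX : reflexive_space X) (l : Z -> R) (M : R) :
    (forall a z w, l (a *: z + w) = a * l z + l w) ->
    (forall z, `|z.1| <= 1 -> `|z.2| <= 1 -> l z <= M) ->
  exists v, forall z, l z = pairing v z.
Proof.
move=> llin lM.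
have [|x x1|q ql] := @dual_of_linear R X (fun x => l (x, 0)) M.
- move=> a x y; rewrite -llin; congr (l (_, _)).
  by rewrite /= scaler0 addr0.
- by apply: lM; rewrite //= normr0.
have [|p p1|F Fl] := @dual_of_linear R (dual_space X) (fun p => l (0, p)) M.
- move=> a p p'; rewrite -llin; congr (l (_, _)).
  by rewrite /= scaler0 addr0.
- by apply: lM; rewrite //= normr0.
have [y Fy] := reflX F; exists (y, q) => -[x p].
rewrite /pairing /= ql -Fy Fl -[l (x, 0)]mul1r -llin; congr (l (_, _)) => /=.
  by rewrite scale1r addr0.
by rewrite scaler0 add0r.
Qed.

(* [C] plays the role of the epigraph of a convex function [f]. Hahn-Banach is
   applied to [z |-> inf_w (f w + energy (w - z))], which is bounded on a
   neighbourhood of the origin, whence the continuity of the functional. *)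
Theorem energy_duality (reflX : reflexive_space X) (C : set (Z * R)) :
    convex_graph C -> C !=set0 ->
    (forall w r, C (w, r) -> 0 <= r + energy w) ->
  exists v, forall w r, C (w, r) -> pairing v w + energy v <= r.
Proof.
move=> Ccvx [[w0 r0] C0] Cge0.
pose S := [set zr : Z * R |
  exists w r, C (w, r) /\ r + energy (w - zr.1) <= zr.2].
have [||r|l [llin lS]] := @hahn_banach R Z S.
- move=> x1 x2 s1 s2 t t01 [w1 [r1 [/= C1 h1]]] [w2 [r2 [/= C2 h2]]].
  exists (t *: w1 + (1 - t) *: w2), (t * r1 + (1 - t) * r2).
  split; first exact: Ccvx.
  rewrite /= opprD addrACA -!scalerBr.
  have := energy_convex (w1 - x1) (w2 - x2) t01.
  by have /andP[t0 t1] := t01; nra.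
- by move=> x; exists (r0 + energy (w0 - x)), w0, r0.
- move=> [w [s [Cws /=]]]; rewrite subr0; apply: le_trans.
  exact: Cge0 Cws.
have l_le w r u : C (w, r) -> l (w - u) <= r + energy u.
  move=> Cwr; apply: lS; exists w, r; split=> //=.
  by rewrite subKr.
have [z z1 z2|v lv] := pairing_of_linear reflX
  (M := r0 + ((`|w0.1| + 1) ^+ 2 + (`|w0.2| + 1) ^+ 2) / 2) llin.
  have := l_le _ _ (w0 - z) C0; rewrite subKr => /le_trans; apply.
  have sq (V : normedModType R) (x y : V) : `|y| <= 1 ->
      `|x - y| ^+ 2 <= (`|x| + 1) ^+ 2.
    move=> y1; rewrite ler_pXn2r// ?nnegrE ?addr_ge0//.
    by rewrite (le_trans (ler_normB _ _))// lerD2l.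
  have := sq _ w0.1 _ z1; have := sq _ w0.2 _ z2.
  by rewrite /energy /=; lra.
(* With [w] fixed, the supremum over [u] of the bounds [l_le] produces [energy v]. *)
exists v => w r Cwr; rewrite addrC -lerBrDr.
apply: energy_le_of_conjugate => u.
by have := l_le _ _ u Cwr; rewrite lv pairingDr pairingNr; lra.
Qed.

End pairing.

(** * Selfdual Lagrangians and the maximality of their fields *)

Section selfdual.
Context {R : realType} {X : normedModType R}.
Local Notation Z := (X * dual_space X)%type.
Implicit Types (L : Z -> \bar R) (z w v : Z) (T : X -> set (dual_space X)).

Lemma legendre_ge L z w (m : R) : (L w <= m%:E)%E ->
  ((pairing z w - m)%:E <= legendre L (z.2, z.1))%E.
Proof.
move=> Lw; apply: le_trans (ereal_sup_ubound _); last by exists w.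
by rewrite /= EFinB leeB// /pairing EFinD.
Qed.

Lemma legendre_le L z (c : \bar R) : (forall w, L w != -oo%E) ->
    (forall w (m : R), L w = m%:E -> ((pairing z w - m)%:E <= c)%E) ->
  (legendre L (z.2, z.1) <= c)%E.
Proof.
move=> LNy Lc; apply: ge_ereal_sup => _ [w _ <-] /=.
case Lw : (L w) => [m||]; first exact: Lc Lw.
- by rewrite addeNy leNye.
- by have := LNy w; rewrite Lw.
Qed.

Lemma pairing_continuous w : continuous (pairing ^~ w).
Proof.
have fl : linear (pairing ^~ w : Z -> R^o).
  by move=> a z v; rewrite pairingDl pairingZl.
pose fL := GRing.isLinear.Build R Z R^o *:%R (pairing ^~ w : Z -> R^o) fl.
pose g : {linear Z -> R^o} := HB.pack (pairing ^~ w : Z -> R^o) fL.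
suff : continuous g by [].
apply/linear_bounded_continuous/bounded_funP => r.
exists (r * `|w.1| + `|w.2| * r) => z.
rewrite prod_normE ge_max => /andP[z1 z2].
apply: (le_trans (ler_normD (z.2 w.1) (w.2 z.1))); apply: lerD.
  by apply: (le_trans (dual_normP _ _)); rewrite ler_wpM2r.
by apply: (le_trans (dual_normP _ _)); rewrite ler_wpM2l// dual_norm_ge0.
Qed.

(** A conjugate is a supremum of continuous affine functions, hence convex and lower
    semicontinuous. *)
Lemma selfdual_of_legendre L : (forall z, L z != -oo%E) ->
  (forall p u, legendre L (p, u) = L (u, p)) -> selfdual_lagrangian L.
Proof.
move=> LNy LL; have Lge z w (m : R) : L w = m%:E ->
    ((pairing z w - m)%:E <= L z)%E.
  by case: z => u p Lw; rewrite -LL; apply: (legendre_ge (u, p)); rewrite Lw.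
split=> //.
- move=> x y t /andP[t0 t1].
  have [->|t_neq0] := eqVneq t 0.
    by rewrite scale0r add0r mul0e add0e subr0 scale1r mul1e.
  have [->|t_neq1] := eqVneq t 1.
    by rewrite subrr scale0r addr0 mul0e adde0 scale1r mul1e.
  have t_gt0 : 0 < t by rewrite lt_neqAle eq_sym t_neq0.
  have t'_gt0 : 0 < 1 - t by rewrite subr_gt0 lt_neqAle t_neq1.
  case Lx : (L x) => [a||]; last by have := LNy x; rewrite Lx.
    case Ly : (L y) => [b||]; last by have := LNy y; rewrite Ly.
      set z := _ + _; rewrite [z]surjective_pairing -LL -!EFinM -EFinD.
      apply: legendre_le => // w m Lw; rewrite lee_fin !pairingE.
      have := Lge x _ _ Lw; have := Lge y _ _ Lw; rewrite Lx Ly !lee_fin.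
      by nra.
    by rewrite gt0_muley ?lte_fin// -EFinM addey// leey.
  rewrite gt0_muley ?lte_fin// addye ?leey//.
  case: (L y) (LNy y) => [r _||]// _.
  by rewrite gt0_muley ?lte_fin.
- move=> z a; rewrite [z in L z]surjective_pairing -LL.
  move=> /ereal_sup_gt[_ [w _ <-]] /=.
  case Lw : (L w) => [m||]; last by have := LNy w; rewrite Lw.
    rewrite -[ltRHS]/((pairing z w - m)%:E) lte_fin => az.
    exists [set y | a < pairing y w - m].
      have az' : a + m < pairing z w by rewrite -ltrBrDr.
      apply: filterS (cvgr_gt _ (@pairing_continuous w z) _ az') => y /=.
      by rewrite ltrBrDr.
    move=> y ay; apply: lt_le_trans (Lge y _ _ Lw).
    by rewrite lte_fin.
  by rewrite addeNy ltNge leNye.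
Qed.

(** The Fenchel-Young inequality of [z] with itself, where selfduality makes both terms [L z]. *)
Lemma selfdual_ge L z : selfdual_lagrangian L ->
  ((pairing z z / 2)%:E <= L z)%E.
Proof.
move=> [LNy _ _ LL]; case Lz : (L z) (LNy z) => [m||]// _; last exact: leey.
have := @legendre_ge L z z m; rewrite LL -surjective_pairing Lz.
move=> /(_ (lexx _)); rewrite !lee_fin; lra.
Qed.

Lemma dbarE L z : dbar L z.1 z.2 <-> L z = (pairing z z / 2)%:E.
Proof.
have -> : pairing z z / 2 = z.2 z.1 by rewrite /pairing; field.
case: z => u p; rewrite /dbar /=.
case: (L (u, p)) => [m||]; split => //.
  by rewrite -EFinB => -[/eqP]; rewrite subr_eq0 => /eqP ->.
by move=> [->]; rewrite -EFinB subrr.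
Qed.

Lemma monotone_setP (G : set Z) :
  monotone_set G <-> forall z w, G z -> G w -> 0 <= pairing (z - w) (z - w).
Proof.
have e (z : Z) : pairing z z = 2 * z.2 z.1 by rewrite /pairing; ring.
split=> [Gm [u p] [v q] Gz Gw|Gm u p v q Gz Gw].
  by rewrite e mulr_ge0//; apply: Gm.
by have := Gm _ _ Gz Gw; rewrite e pmulr_rge0.
Qed.

(** At the midpoint, [selfdual_ge] and convexity give [B(z+w,z+w)/8 <= (B(z,z) + B(w,w))/4], that is
    [0 <= B(z-w,z-w)]. *)
Lemma dbar_monotone L :
  selfdual_lagrangian L -> monotone_set (op_graph (dbar L)).
Proof.
move=> Lsd; apply/monotone_setP => z w /dbarE Lz /dbarE Lw.
have [_ Lcvx _ _] := Lsd.
have t01 : 0 <= (2^-1 : R) <= 1 by rewrite invr_ge0 ler0n invf_le1 ?ler1n.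
have := le_trans (selfdual_ge _ Lsd) (Lcvx z w _ t01).
by rewrite Lz Lw -!EFinM -EFinD lee_fin !pairingE (pairingC w z); lra.
Qed.

Lemma dbar_maximal_monotone L : reflexive_space X -> proper_function L ->
  selfdual_lagrangian L -> maximal_monotone (dbar L).
Proof.
move=> reflX [LNy [y Ly]] Lsd; split; first exact: dbar_monotone.
have [_ Lcvx _ LL] := Lsd.
move=> G /monotone_setP Gmono LG z Gz.
pose c := pairing z z / 2.
(* The epigraph of [L(z+w) - B(z,w) - B(z,z)/2] as a function of [w]; [selfdual_ge] bounds it below
   by [B(w,w)/2], hence by [- energy w]. *)
pose C := [set wr : Z * R |
  (L (z + wr.1)%R <= (wr.2 + pairing z wr.1 + c)%:E)%E].
have [|||v Cv] := @energy_duality R X reflX C.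
- move=> w1 w2 r s t t01; rewrite /C /= => h1 h2.
  have -> : z + (t *: w1 + (1 - t) *: w2) =
      t *: (z + w1) + (1 - t) *: (z + w2).
    by rewrite !scalerDr addrACA -scalerDl [t + _]addrC subrK scale1r.
  apply: (le_trans (Lcvx _ _ _ t01)); have /andP[t0 t1] := t01.
  have t0e : (0 <= t%:E)%E by rewrite lee_fin.
  have t1e : (0 <= (1 - t)%:E)%E by rewrite lee_fin subr_ge0.
  apply: (le_trans (leeD (lee_wpmul2l t0e h1) (lee_wpmul2l t1e h2))).
  rewrite -!EFinM -EFinD lee_fin !pairingE; lra.
- case Lye : (L y) (LNy y) Ly => [m||]// _ _.
  exists (y - z, m - pairing z (y - z) - c).
  by rewrite /C /= addrC subrK Lye lee_fin; lra.
- move=> w r; rewrite /C /= => /(le_trans (selfdual_ge _ Lsd)).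
  rewrite lee_fin !pairingE (pairingC w z) /c.
  by have := pairing_le_energy w (- w); rewrite pairingNr energyN; lra.
(* As an affine minorant of [L], the bound [Cv] has slope [z + v], so selfduality makes it an upper
   bound on [L (z + v)]. *)
have Lzv : (L (z + v)%R <= (c + pairing z v - energy v)%:E)%E.
  rewrite [z + v]surjective_pairing -LL; apply: legendre_le => // w m Lw.
  have : C (w - z, m - pairing z (w - z) - c).
    rewrite /C /= addrC subrK Lw lee_fin; lra.
  move=> /Cv; rewrite lee_fin !pairingE (pairingC v z) /c.
  lra.
have := le_trans (selfdual_ge _ Lsd) Lzv.
rewrite lee_fin !pairingE (pairingC v z) => hv.
have Lzv' : L (z + v) = (pairing (z + v) (z + v) / 2)%:E.
  apply/eqP; rewrite eq_le selfdual_ge// andbT (le_trans Lzv)// lee_fin.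
  rewrite !pairingE (pairingC v z) /c; have := pairing_le_energy v (- v).
  rewrite pairingNr energyN; lra.
have /LG Gzv : op_graph (dbar L) (z + v) by apply/dbarE.
have := Gmono _ _ Gzv Gz; rewrite addrC addKr => v0.
have : v = 0 by apply: energy_eq0; move: hv; rewrite /c; lra.
by move=> v00; move: Lzv'; rewrite v00 addr0 => /dbarE.
Qed.

End selfdual.

(** * The proximal average and the converse *)

Lemma halves_add (R : numFieldType) (V : lmodType R) (a b : V) :
  2^-1 *: (a + b) + 2^-1 *: (a - b) = a.
Proof.
rewrite -scalerDr addrACA subrr addr0 -[X in X + X]scale1r -scalerDl scalerA.
by rewrite mulVf ?scale1r ?pnatr_eq0.
Qed.

Lemma halves_sub (R : numFieldType) (V : lmodType R) (a b : V) :
  2^-1 *: (a + b) - 2^-1 *: (a - b) = b.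
Proof. by rewrite -scalerN opprB (addrC a) halves_add. Qed.

Section proximal_average.
Context {R : realType} {X : normedModType R}.
Local Notation Z := (X * dual_space X)%type.
Implicit Types (z w v a b y : Z) (s t r : R) (G : set Z).

(* Convex functions are handled through their real epigraphs, [f a <= s], so
   that no arithmetic with infinite values is needed. *)
Definition fitzpatrick_epi G a s :=
  forall w, G w -> pairing a w - pairing w w / 2 <= s.

Definition fitzpatrick_conj_epi G b t :=
  forall a s, fitzpatrick_epi G a s -> pairing b a - s <= t.

Lemma fitzpatrick_epi_diag G z : monotone_set G -> G z ->
  fitzpatrick_epi G z (pairing z z / 2).
Proof.
move=> /monotone_setP Gm Gz w Gw; have := Gm _ _ Gz Gw.
by rewrite !pairingE (pairingC w z); lra.
Qed.

Lemma fitzpatrick_conj_epi_diag G z : G z ->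
  fitzpatrick_conj_epi G z (pairing z z / 2).
Proof. by move=> Gz a s /(_ z Gz); rewrite (pairingC a z); lra. Qed.

(** The Fitzpatrick function is a supremum of affine functions whose data [(w, pairing w w / 2)] lie
    in the epigraph of its conjugate. *)
Lemma fitzpatrick_biconj G a s :
  (forall b t, fitzpatrick_conj_epi G b t -> pairing a b - t <= s) ->
  fitzpatrick_epi G a s.
Proof. by move=> h w Gw; apply: h; exact: fitzpatrick_conj_epi_diag. Qed.

Lemma fitzpatrick_epi_convex G a b s t r : 0 <= r <= 1 ->
    fitzpatrick_epi G a s -> fitzpatrick_epi G b t ->
  fitzpatrick_epi G (r *: a + (1 - r) *: b) (r * s + (1 - r) * t).
Proof.
move=> /andP[r0 r1] ha hb w Gw; have := ha _ Gw; have := hb _ Gw.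
by rewrite !pairingE; nra.
Qed.

Lemma fitzpatrick_conj_epi_convex G a b s t r : 0 <= r <= 1 ->
    fitzpatrick_conj_epi G a s -> fitzpatrick_conj_epi G b t ->
  fitzpatrick_conj_epi G (r *: a + (1 - r) *: b) (r * s + (1 - r) * t).
Proof.
move=> /andP[r0 r1] ha hb w q hw; have := ha _ _ hw; have := hb _ _ hw.
by rewrite !pairingE; nra.
Qed.

Definition proximal_average_epi G z r := exists w s t,
  [/\ fitzpatrick_epi G (z + w) s, fitzpatrick_conj_epi G (z - w) t &
      r = (s + t) / 2 + energy w].

Definition proximal_average G z : \bar R :=
  ereal_inf [set r%:E | r in proximal_average_epi G z].

(** Each function at one point is paired with the other function at the other point; the cross terms
    reduce to [B(w,v)], which the energies absorb. *)
Lemma proximal_average_epi_young G z y r s :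
    proximal_average_epi G z r -> proximal_average_epi G y s ->
  pairing z y <= r + s.
Proof.
move=> [w [s1 [t1 [hs1 ht1 ->]]]] [v [s2 [t2 [hs2 ht2 ->]]]].
have := ht1 _ _ hs2; have := ht2 _ _ hs1.
have := pairing_le_energy w v.
rewrite !pairingE (pairingC y z) (pairingC v w) (pairingC y w) (pairingC v z).
by lra.
Qed.

Lemma proximal_average_ge G z :
  ((pairing z z / 2)%:E <= proximal_average G z)%E.
Proof.
apply: le_ereal_inf_tmp => _ [r hr <-]; rewrite lee_fin.
by have := proximal_average_epi_young hr hr; lra.
Qed.

Lemma proximal_average_epi_diag G z : monotone_set G -> G z ->
  proximal_average_epi G z (pairing z z / 2).
Proof.
move=> Gm Gz; exists 0, (pairing z z / 2), (pairing z z / 2).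
rewrite addr0 subr0; split.
- exact: fitzpatrick_epi_diag.
- exact: fitzpatrick_conj_epi_diag.
- by rewrite /energy /= !normr0; lra.
Qed.

Lemma proximal_average_diag G z : monotone_set G -> G z ->
  proximal_average G z = (pairing z z / 2)%:E.
Proof.
move=> Gm Gz; apply/eqP; rewrite eq_le proximal_average_ge andbT.
apply: ereal_inf_lbound; exists (pairing z z / 2) => //.
exact: proximal_average_epi_diag.
Qed.

Lemma conjugate_lub (E : Z -> R -> Prop) v t : (exists a s, E a s) ->
    (forall a s, E a s -> pairing v a - s <= t) ->
  exists2 m, (forall a s, E a s -> pairing v a - s <= m) &
    forall c, (forall a s, E a s -> pairing v a - s <= c) -> m <= c.
Proof.
move=> [a [s Eas]] Et.
pose A := [set r | exists a s, E a s /\ r = pairing v a - s].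
have A0 : A !=set0 by exists (pairing v a - s), a, s.
exists (sup A) => [b u Ebu|c hc].
  apply: ub_le_sup; last by exists b, u.
  by exists t => _ [b' [u' [E' ->]]]; exact: Et.
by apply: ge_sup => // _ [b [u [Ebu ->]]]; exact: hc.
Qed.

(* The energy duality is applied in the variable [(a - b) / 2], where [a] and
   [b] are the arguments of the two averaged functions; the dual variable [v]
   splits [z] into [z + v] and [z - v]. *)
Lemma proximal_average_epi_conj (reflX : reflexive_space X) G z (c : R) :
    monotone_set G -> G !=set0 ->
    (forall y r, proximal_average_epi G y r -> pairing z y - r <= c) ->
  (proximal_average G z <= c%:E)%E.
Proof.
move=> Gm [g Gg] hc.
pose C := [set wr : Z * R | exists a b s t, [/\ fitzpatrick_epi G a s,
  fitzpatrick_conj_epi G b t, wr.1 = 2^-1 *: (a - b) &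
  wr.2 = (s + t) / 2 - pairing z (a + b) / 2 + c]].
have [|||v Cv] := @energy_duality R X reflX C.
- move=> w1 w2 r1 r2 q q01 [a1 [b1 [s1 [t1 [/= ha1 hb1 -> ->]]]]].
  move=> [a2 [b2 [s2 [t2 [/= ha2 hb2 -> ->]]]]].
  exists (q *: a1 + (1 - q) *: a2), (q *: b1 + (1 - q) *: b2).
  exists (q * s1 + (1 - q) * s2), (q * t1 + (1 - q) * t2); split => /=.
  + exact: fitzpatrick_epi_convex.
  + exact: fitzpatrick_conj_epi_convex.
  + by rewrite opprD addrACA -!scalerBr [in RHS]scalerDr !scalerA !(mulrC 2^-1).
  + by rewrite !pairingE; lra.
- exists (2^-1 *: (g - g), (pairing g g / 2 + pairing g g / 2) / 2 -
    pairing z (g + g) / 2 + c), g, g, (pairing g g / 2), (pairing g g / 2).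
  split => //; [exact: fitzpatrick_epi_diag|exact: fitzpatrick_conj_epi_diag].
- move=> _ _ [a [b [s [t [/= ha hb -> ->]]]]].
  (* The half-sum and the half-difference recover [a] and [b], so [hc] is exactly the lower bound
     asked of [C]. *)
  have /hc : proximal_average_epi G (2^-1 *: (a + b))
      ((s + t) / 2 + energy (2^-1 *: (a - b))).
    exists (2^-1 *: (a - b)), s, t; split=> //.
      by rewrite halves_add.
    by rewrite halves_sub.
  rewrite !pairingE; lra.
have Cvab a b s t : fitzpatrick_epi G a s -> fitzpatrick_conj_epi G b t ->
    (pairing (z + v) a - s) + (pairing (z - v) b - t) <= 2 * (c - energy v).
  move=> ha hb.
  have : C (2^-1 *: (a - b), (s + t) / 2 - pairing z (a + b) / 2 + c).
    by exists a, b, s, t.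
  by move=> /Cv; rewrite !pairingE; lra.
have Fg := fitzpatrick_epi_diag Gm Gg.
have Fg' := fitzpatrick_conj_epi_diag Gg.
(* Freezing [b] at [g] in [Cvab] bounds the conjugate at [z + v]; freezing [a] below does the same
   at [z - v]. *)
have [||t ht tmin] := @conjugate_lub (fitzpatrick_epi G) (z + v)
  (2 * (c - energy v) - (pairing (z - v) g - pairing g g / 2)).
- by exists g, (pairing g g / 2).
- by move=> a s ha; have := Cvab _ _ _ _ ha Fg'; lra.
have [||s hs smin] := @conjugate_lub (fitzpatrick_conj_epi G) (z - v)
  (2 * (c - energy v) - (pairing (z + v) g - pairing g g / 2)).
- by exists g, (pairing g g / 2).
- by move=> b u hb; have := Cvab _ _ _ _ Fg hb; lra.
apply: (@le_trans _ _ (((s + t) / 2 + energy (- v))%:E)).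
  apply: ereal_inf_lbound; exists ((s + t) / 2 + energy (- v)) => //.
  (* The sign is forced: [t] is a value of the conjugate at [z + v], and [s] one of the biconjugate
     at [z - v]. *)
  exists (- v), s, t; split=> //; first exact: fitzpatrick_biconj.
  by rewrite opprK.
rewrite energyN lee_fin.
suff : s + t <= 2 * (c - energy v) by lra.
rewrite -lerBrDl; apply: tmin => a u ha.
rewrite lerBrDl -lerBrDr; apply: smin => b q hb.
by have := Cvab _ _ _ _ ha hb; lra.
Qed.

(** The conjugate is at most the average by [proximal_average_epi_young], and at least the average
    by [proximal_average_epi_conj]. *)
Lemma proximal_average_selfdual (reflX : reflexive_space X) G :
  monotone_set G -> G !=set0 -> selfdual_lagrangian (proximal_average G).
Proof.
move=> Gm G0.
have LNy z : proximal_average G z != -oo%E.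
  by have := proximal_average_ge G z; case: (proximal_average G z).
apply: selfdual_of_legendre => // p u.
apply/eqP; rewrite eq_le; apply/andP; split.
  apply: (@legendre_le _ _ _ (u, p)) => // w m Lw.
  apply: le_ereal_inf_tmp => _ [r hr <-]; rewrite lee_fin lerBlDr -lerBlDl.
  rewrite -lee_fin -Lw; apply: le_ereal_inf_tmp => _ [s hs <-].
  by rewrite lee_fin lerBlDl; exact: proximal_average_epi_young hs.
have lege w r : proximal_average_epi G w r ->
    ((pairing (u, p) w - r)%:E <= legendre (proximal_average G) (p, u))%E.
  move=> hr; apply: (@legendre_ge _ _ _ (u, p)).
  by apply: ereal_inf_lbound; exists r.
case E : (legendre _ _) => [c||]; last 2 first.
- exact: leey.
- have [g Gg] := G0.
  by have := lege _ _ (proximal_average_epi_diag Gm Gg); rewrite E.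
apply: proximal_average_epi_conj => // w r /lege.
by rewrite E lee_fin.
Qed.

Lemma maximal_monotone_dbar (reflX : reflexive_space X)
    (T : X -> set (dual_space X)) :
    maximal_monotone T -> op_domain T !=set0 ->
  exists L : Z -> \bar R, selfdual_lagrangian L /\ T = dbar L.
Proof.
move=> [Tmono Tmax] [u [p Tup]].
have T0 : op_graph T !=set0 by exists (u, p).
have Lsd := proximal_average_selfdual reflX Tmono T0.
exists (proximal_average (op_graph T)); split=> //.
have TL : op_graph T `<=` op_graph (dbar (proximal_average (op_graph T))).
  by move=> z Tz; apply/dbarE; exact: proximal_average_diag.
apply/funext => x; apply/seteqP; split=> q; first exact: (TL (x, q)).
exact: (Tmax _ (dbar_monotone Lsd) TL (x, q)).
Qed.

End proximal_average.

Theorem theorem1p1 (R : realType) (X : completeNormedModType R)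
    (reflX : reflexive_space X) :
  (forall L : X * dual_space X -> \bar R,
     proper_function L -> selfdual_lagrangian L -> maximal_monotone (dbar L)) /\
  (forall T : X -> set (dual_space X),
     maximal_monotone T -> op_domain T !=set0 ->
     exists L : X * dual_space X -> \bar R, selfdual_lagrangian L /\ T = dbar L).
Proof.
split=> [L Lp Lsd|T]; first exact: dbar_maximal_monotone.
exact: maximal_monotone_dbar.
Qed.
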